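(* Let $n,p,m$ be positive integers, $\mathcal{U}\subseteq\mathbb{R}^m$, $\mathcal{S}_x\subseteq\mathbb{R}^n$, and let $f:\mathbb{R}^n\times\mathbb{R}^p\times\mathbb{R}^m\to\mathbb{R}^n$ and $g:\mathbb{R}^p\times\mathbb{R}^n\times\mathbb{R}^m\to\mathbb{R}^p$. Suppose that the following hold. (i) $f$ and $g$ are Lipschitz continuous with constants $L_f>0$ and $L_g>0$, respectively. (ii) There is a continuously differentiable function $z^{\mathrm{eq}}:\mathcal{S}_x\times\mathcal{U}\to\mathbb{R}^p$ such that $g(z^{\mathrm{eq}}(x,u),x,u)=0$ for all $x\in\mathcal{S}_x$ and $u\in\mathcal{U}$. (iii) There are a continuously differentiable function $h:\mathbb{R}^n\to\mathbb{R}$ whose zero-superlevel set $\mathcal{C}:=\{x\in\mathbb{R}^n\mid h(x)\ge 0\}$ is compact and satisfies $\mathcal{C}\subseteq\mathcal{S}_x$, a Lipschitz continuous (with constant $L_\pi$) and differentiable function $\pi:\mathcal{C}\to\mathcal{U}$, a Lipschitz continuous (with constant $L_\alpha$) function $\alpha\in\mathcal{K}_\infty$, and a constant $\eta>0$ such that, for all $x\in\mathcal{C}$, $$\nabla h(x)^\top f\bigl(x,z^{\mathrm{eq}}(x,\pi(x)),\pi(x)\bigr)\ \ge\ -\alpha(h(x))+\eta .$$ (iv) There are a continuous and differentiable function $U:\mathbb{R}^p\to\mathbb{R}$ and constants $b_1,b_2,b_3,b_4>0$ such that, for all $\tilde z\in\mathbb{R}^p$, $\bar x\in\mathcal{S}_x$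 and $\bar u\in\mathcal{U}$, $$b_1\|\tilde z\|^2\le U(\tilde z)\le b_2\|\tilde z\|^2,$$ $$\nabla U(\tilde z)^\top g\bigl(\tilde z+z^{\mathrm{eq}}(\bar x,\bar u),\bar x,\bar u\bigr)\le -b_3\|\tilde z\|^2,$$ $$\|\nabla U(\tilde z)\|\le b_4\|\tilde z\|.$$ Define $V:\mathcal{C}\times\mathbb{R}^p\to\mathbb{R}$ by $$V(x,z):=h(x)-U\bigl(z-z^{\mathrm{eq}}(x,\pi(x))\bigr),$$ and let $\mathcal{C}_{\mathrm{full}}:=\{(x,z)\in\mathcal{C}\times\mathbb{R}^p\mid V(x,z)\ge 0\}$ be its zero-superlevel set. Then there exists $\bar\epsilon>0$ such that, for all $\epsilon\in(0,\bar\epsilon)$, the set $\mathcal{C}_{\mathrm{full}}$ is forward invariant for the closed-loop system $$\dot x(t)=f\bigl(x(t),z(t),\pi(x(t))\bigr),\qquad \epsilon\,\dot z(t)=g\bigl(z(t),x(t),\pi(x(t))\bigr).$$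
   Context: $\|\cdot\|$ is the Euclidean norm and $\mathbb{R}_+=\{x\in\mathbb{R}\mid x\ge 0\}$. A continuous function $\alpha:\mathbb{R}_+\to\mathbb{R}_+$ is of class $\mathcal{K}_\infty$ (written $\alpha\in\mathcal{K}_\infty$) if it is strictly increasing, $\alpha(0)=0$ and $\lim_{r\to\infty}\alpha(r)=\infty$. The underlying open system is the feedback interconnection $\dot x(t)=f(x(t),z(t),u(t))$, $\epsilon\dot z(t)=g(z(t),x(t),u(t))$, with slow state $x(t)\in\mathbb{R}^n$, fast state $z(t)\in\mathbb{R}^p$, input $u(t)\in\mathcal{U}$, $t\in\mathbb{R}_+$, and timescale parameter $\epsilon>0$; $f$ and $g$ do not depend on $\epsilon$. The closed-loop system is obtained by setting $u(t)=\pi(x(t))$. The set $\mathcal{S}_x$ is the safe set for the slow state. A set is forward invariant for an autonomous system of differential equations if, for every initial condition in the set, the corresponding solution belongs to the set for all $t\ge 0$. *)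

(* Defs.v *)
From HB Require Import structures.
From mathcomp Require Import all_boot all_order all_algebra.
From mathcomp Require Import all_classical all_reals all_analysis.
Set Implicit Arguments.
Unset Strict Implicit.
Unset Printing Implicit Defensive.
Import Order.TTheory GRing.Theory Num.Theory.
Import numFieldNormedType.Exports.
Local Open Scope classical_set_scope.
Local Open Scope ring_scope.

(* The library norm on 'rV[R]_k is the sup norm; the Euclidean norm is
   introduced here.  Both induce the same topology and the same notions of
   limit and differentiability, so those are taken from the library. *)
Definition dotv (R : realType) (k : nat) (v w : 'rV[R]_k) : R :=
  \sum_i v 0 i * w 0 i.

Definition enorm (R : realType) (k : nat) (v : 'rV[R]_k) : R :=
  Num.sqrt (dotv v v).

Definition elipschitz_on (R : realType) (a b : nat) (L : R)
    (D : set 'rV[R]_a) (F : 'rV[R]_a -> 'rV[R]_b) : Prop :=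
  forall x x', D x -> D x' -> enorm (F x - F x') <= L * enorm (x - x').

(* The square root is the Euclidean norm of the difference in R^(a+b+c). *)
Definition elipschitz3 (R : realType) (a b c d : nat) (L : R)
    (F : 'rV[R]_a -> 'rV[R]_b -> 'rV[R]_c -> 'rV[R]_d) : Prop :=
  forall x x' y y' u u',
    enorm (F x y u - F x' y' u') <=
    L * Num.sqrt (enorm (x - x') ^+ 2 + enorm (y - y') ^+ 2
                  + enorm (u - u') ^+ 2).

Definition gradient (R : realType) (k : nat) (F : 'rV[R]_k -> R)
    (x : 'rV[R]_k) : 'rV[R]_k :=
  \row_i 'D_(delta_mx 0 i) F x.

(* Functions whose domain D is a proper, not necessarily open, subset are
   represented by total functions of which only the values on D matter.
   Differentiability is relative to D: F y = F x + dF (y - x) + o(y - x) as y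
   tends to x inside D.  At interior points of D this is the usual notion; in
   general dF need not be unique. *)
Definition is_diff_within (R : realType) (V W : normedModType R) (D : set V)
    (F : V -> W) (x : V) (dF : {linear V -> W}) : Prop :=
  continuous dF /\
  forall e : R, 0 < e -> \forall y \near within D (nbhs x),
    `|F y - F x - dF (y - x)| <= e * `|y - x|.

Definition differentiable_on (R : realType) (V W : normedModType R)
    (D : set V) (F : V -> W) : Prop :=
  forall x, D x -> exists dF : {linear V -> W}, is_diff_within D F x dF.

(* For finite-dimensional V, the only case used, pointwise continuity of
   x |-> DF x is continuity in the operator norm.  Every restriction to D of a
   C^1 function on an open neighbourhood of D is C^1 in this sense. *)
Definition C1_on (R : realType) (V W : normedModType R) (D : set V)
    (F : V -> W) : Prop :=
  exists DF : V -> {linear V -> W},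
    (forall x, D x -> is_diff_within D F x (DF x)) /\
    (forall v, {within D, continuous (fun x => DF x v)}).

Definition class_Kinfty (R : realType) (alpha : R -> R) : Prop :=
  [/\ {within [set` `[0, +oo[], continuous alpha},
      forall r, 0 <= r -> 0 <= alpha r,
      forall r s, 0 <= r -> r < s -> alpha r < alpha s,
      alpha 0 = 0
    & alpha r @[r --> +oo] --> +oo].

Definition superlevel (R : realType) (T : Type) (h : T -> R) : set T :=
  [set x | 0 <= h x].

(* Classical solution of w' = F(w) on [0, T), with T possibly infinite; the
   derivative at t is taken within [0, T), hence is one-sided at t = 0. *)
Definition solution_on (R : realType) (E : normedModType R) (F : E -> E)
    (T : \bar R) (w : R -> E) : Prop :=
  forall t : R, 0 <= t -> (t%:E < T)%E ->
    (s - t)^-1 *: (w s - w t)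
      @[s --> within [set s : R | 0 <= s /\ (s%:E < T)%E] t^'] --> F (w t).

(* A solution starting in S exists for all nonnegative times, and every
   solution starting in S, even one defined on a bounded interval only, stays
   in S as long as it is defined. *)
Definition forward_invariant (R : realType) (E : normedModType R)
    (F : E -> E) (S : set E) : Prop :=
  forall w0, S w0 ->
    (exists w : R -> E, w 0 = w0 /\ solution_on F +oo%E w) /\
    (forall (T : \bar R) (w : R -> E), w 0 = w0 -> solution_on F T w ->
       forall t, 0 <= t -> (t%:E < T)%E -> S (w t)).

(* Vector field of x' = f(x,z,pi x), eps z' = g(z,x,pi x), for eps > 0. *)
Definition closed_loop (R : realType) (n p m : nat)
    (f : 'rV[R]_n -> 'rV[R]_p -> 'rV[R]_m -> 'rV[R]_n)
    (g : 'rV[R]_p -> 'rV[R]_n -> 'rV[R]_m -> 'rV[R]_p)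
    (pi : 'rV[R]_n -> 'rV[R]_m) (eps : R)
    (w : 'rV[R]_n * 'rV[R]_p) : 'rV[R]_n * 'rV[R]_p :=
  (f w.1 w.2 (pi w.1), eps^-1 *: g w.2 w.1 (pi w.1)).

Definition Vfun (R : realType) (n p m : nat) (h : 'rV[R]_n -> R)
    (U : 'rV[R]_p -> R) (zeq : 'rV[R]_n * 'rV[R]_m -> 'rV[R]_p)
    (pi : 'rV[R]_n -> 'rV[R]_m) (x : 'rV[R]_n) (z : 'rV[R]_p) : R :=
  h x - U (z - zeq (x, pi x)).

Definition Cfull (R : realType) (n p m : nat) (h : 'rV[R]_n -> R)
    (U : 'rV[R]_p -> R) (zeq : 'rV[R]_n * 'rV[R]_m -> 'rV[R]_p)
    (pi : 'rV[R]_n -> 'rV[R]_m) : set ('rV[R]_n * 'rV[R]_p) :=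
  [set w | superlevel h w.1 /\ 0 <= Vfun h U zeq pi w.1 w.2].

(* Main.v *)
(* Write r = |z - zeq(x, pi x)|.  Where V = 0 we have h = U <= b2 r^2, and
   along a solution V' >= eta - c1 r + (b3 / eps - c2) r^2 with constants c1, c2
   that depend only on bounds over the compact set C, so V' > 0 once eps is
   small.  If moreover h = 0, then r = 0 and the barrier condition gives
   h' >= eta > 0.  Hence a solution in C_full stays there for a short time, and
   C_full being closed, a connectedness argument on the time interval shows that
   it never leaves.  Since x |-> zeq(x, pi x) is only known on C, its derivative along
   the solution is replaced by a local Lipschitz bound that is uniform on C.
   Global existence: off C the value of pi is arbitrary, so the Picard theorem is
   applied with a Lipschitz extension of pi from C; the solution found stays in
   C, hence solves the original system. *)

Require Import Defs.
From HB Require Import structures.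
From mathcomp Require Import all_boot all_order all_algebra.
From mathcomp Require Import all_classical all_reals all_analysis.
From mathcomp Require Import ring lra.
Set Implicit Arguments.
Unset Strict Implicit.
Unset Printing Implicit Defensive.
Import Order.TTheory GRing.Theory Num.Theory.
Import numFieldNormedType.Exports.
Local Open Scope classical_set_scope.
Local Open Scope ring_scope.
(** * One-sided derivatives and real induction *)

Section Derivative.
Context {R : realType}.

(* Equivalent to the limit of difference quotients (hasderivP), but without the
   division, so that estimates also hold at s = t. *)
Definition hasderiv {E : normedModType R} (A : set R) (u : R -> E) (t : R)
    (d : E) : Prop :=
  forall e, 0 < e ->
    \forall s \near t, A s -> `|u s - u t - (s - t) *: d| <= e * `|s - t|.

(** Bridge to the difference quotients of [solution_on]. The excluded point [s = t] is harmless in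
    [hasderiv], where both sides vanish there. *)
Lemma hasderivP (E : normedModType R) (A : set R) (u : R -> E) t d :
  hasderiv A u t d <->
  (s - t)^-1 *: (u s - u t) @[s --> within A t^'] --> d.
Proof.
split=> [ud|/cvgrPdist_le ud].
- apply/cvgrPdist_le => e e0.
  have := ud _ e0; rewrite !near_withinE.
  apply: filterS => s H st As.
  have st0 : s - t != 0 by rewrite subr_eq0.
  rewrite distrC -(@ler_pM2r _ `|s - t|) ?normr_gt0// mulrC -normrZ.
  by rewrite scalerBr scalerA divff// scale1r H.
- move=> e e0; have := ud _ e0; rewrite !near_withinE.
  apply: filterS => s H As; have [->|st] := eqVneq s t.
    by rewrite !subrr scale0r subr0 !normr0 mulr0.
  have st0 : s - t != 0 by rewrite subr_eq0.
  have := H st As; rewrite -(@ler_pM2r _ `|s - t|) ?normr_gt0//.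
  by rewrite distrC mulrC -normrZ scalerBr scalerA divff// scale1r.
Qed.

Lemma is_derive_hasderiv (A : set R) (u : R -> R) (t d : R) :
  is_derive t 1 u d -> hasderiv A u t d.
Proof.
case/is_derive1_caratheodory => g [uE gc gd] e e0.
have : \forall s \near t, `|g t - g s| <= e.
  by move/cvgrPdist_le : gc => /(_ _ e0).
apply: filterS => s gs _.
by rewrite uE -gd [X in _ - X]mulrC -mulrBl normrM ler_wpM2r// distrC.
Qed.


Section HasDeriv.
Context {E : normedModType R}.
Implicit Types (A : set R) (u v : R -> E).

Lemma hasderiv_continuous A u t d : hasderiv A u t d ->
  forall e, 0 < e -> \forall s \near t, A s -> `|u s - u t| <= e.
Proof.
move=> ud e e0.
have d1 : 0 < `|d| + 1 by rewrite ltr_wpDl.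
have ed : 0 < e / (`|d| + 1) by rewrite divr_gt0.
apply: (filterS2 _ _ (near_ball t _ ed) (ud 1 ltr01)) => s.
rewrite /ball/= distrC => ts H /H {}H.
rewrite -(subrK ((s - t) *: d) (u s - u t)) (le_trans (ler_normD _ _))//.
rewrite (le_trans (lerD H (lexx _)))// normrZ.
move: ts; rewrite ltr_pdivlMr//; lra.
Qed.

Lemma hasderiv_sub A u v t d d' : hasderiv A u t d -> hasderiv A v t d' ->
  hasderiv A (fun s => u s - v s) t (d - d').
Proof.
move=> ud vd e e0; have e2 : 0 < e / 2 by rewrite divr_gt0.
have := ud _ e2; have := vd _ e2; apply: filterS2 => s Hv Hu As.
rewrite (splitr e) mulrDl.
have -> : u s - v s - (u t - v t) - (s - t) *: (d - d') =
    (u s - u t - (s - t) *: d) - (v s - v t - (s - t) *: d').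
  have subACA (a b c x : E) : a - b - (c - x) = a - c - (b - x).
    by rewrite opprD addrACA -opprD.
  by rewrite scalerBr (subACA (u s) (v s)) (subACA (u s - u t)).
by rewrite (le_trans (ler_normB _ _))// lerD ?Hu ?Hv.
Qed.

Lemma hasderiv_cst A (c : E) t : hasderiv A (fun=> c) t 0.
Proof.
move=> e e0; near=> s; rewrite subrr scaler0 subr0 normr0 => _.
by rewrite mulr_ge0// ltW.
Unshelve. all: by end_near. Qed.

Lemma hasderivDc A u t d (c : E) : hasderiv A u t d ->
  hasderiv A (fun s => c + u s) t d.
Proof.
by move=> ud e /ud; apply: filterS => s H As; rewrite opprD addrACA subrr add0r H.
Qed.

End HasDeriv.

(** If [P] failed at [t], take the supremum [c] of the times up to which [P] holds throughout: the
    left-closure hypothesis gives [P c], and the right-step hypothesis carries [P] beyond [c], a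
    contradiction. *)
Lemma real_induction (T : \bar R) (P : R -> Prop) :
  P 0 ->
  (forall t, 0 <= t -> (t%:E < T)%E -> P t ->
     \forall s \near t, t < s -> (s%:E < T)%E -> P s) ->
  (forall t, 0 < t -> (t%:E < T)%E -> (forall s, 0 <= s < t -> P s) -> P t) ->
  forall t, 0 <= t -> (t%:E < T)%E -> P t.
Proof.
move=> P0 Pr Pl t t0 tT; apply: contrapT => nPt.
pose S := [set s | 0 <= s <= t /\ forall r, 0 <= r <= s -> P r].
have S0 : S 0.
  by split=> [|r]; [rewrite lexx|rewrite -eq_le => /eqP <-].
have Sub : ubound S t by move=> s [] /andP[].
have hS : has_sup S by split; [exists 0|exists t].
pose c := sup S.
have c0 : 0 <= c by apply: ub_le_sup => //; case: hS.
have ct : c <= t by apply: ge_sup => //; exists 0.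
have cT : (c%:E < T)%E by apply: le_lt_trans tT; rewrite lee_fin.
have Pltc s : 0 <= s < c -> P s.
  move=> /andP[s0 sc]; have [r [_ Sr] sr] := sup_gt hS.1 sc.
  by apply: Sr; rewrite s0 ltW.
have Pc : P c.
  have [<-//|cn0] := eqVneq 0 c.
  by apply: Pl => //; rewrite lt_neqAle cn0.
have ltct : c < t.
  by rewrite lt_neqAle ct andbT; apply: contra_notN nPt => /eqP <-.
have /nbhs_ballP[d /= d0 H] := Pr _ c0 cT Pc.
(* Half the radius keeps all of []c, s]] inside the ball and the minimum keeps [s] below [t], so [s]
   would be a member of [S] above its supremum. *)
pose s := Num.min t (c + d / 2).
have cs : c < s by rewrite lt_min ltct ltrDl divr_gt0.
suff /(ub_le_sup _) : S s by move=> /(_ hS.2); rewrite leNgt cs.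
split=> [|r /andP[r0 rs]]; first by rewrite (le_trans c0 (ltW cs)) ge_min lexx.
have [rc|cr|->//] := ltgtP r c; first by apply: Pltc; rewrite r0.
apply: H => //=.
  rewrite /ball/= ltr_distlC; apply/andP; split.
    by rewrite (lt_trans _ cr)// ltrBlDr ltrDl.
  rewrite (le_lt_trans rs)// (@le_lt_trans _ _ (c + d / 2))//; last lra.
  by rewrite ge_min lexx ?orbT.
by apply: le_lt_trans tT; rewrite lee_fin (le_trans rs)// ge_min lexx.
Qed.

(** Real induction on the inequality relaxed by a small linear term, which absorbs the remainders of
    the two derivatives. It plays the part of the norm inequality for integrals. *)
Lemma mean_value_le (E : normedModType R) (u du : R -> E) (v dv : R -> R) :
  (forall t, 0 <= t -> hasderiv [set s | 0 <= s] u t (du t)) ->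
  (forall t, 0 <= t -> hasderiv [set s | 0 <= s] v t (dv t)) ->
  (forall t, 0 <= t -> `|du t| <= dv t) ->
  forall t, 0 <= t -> `|u t - u 0| <= v t - v 0.
Proof.
move=> ud vd duv t t0; apply/ler_addgt0Pr => e e0.
have t1 : 0 < t + 1 by rewrite ltr_wpDl.
(* The relaxation costs [a * t <= e] at the final time; the [+ 1] covers [t = 0]. *)
pose a := e / (t + 1).
have a0 : 0 < a by rewrite divr_gt0.
suff H : `|u t - u 0| <= v t - v 0 + a * t.
  rewrite (le_trans H)// lerD2l /a mulrAC ler_pdivrMr//; nra.
pose P t := `|u t - u 0| <= v t - v 0 + a * t.
apply: (@real_induction +oo%E P) => //; rewrite ?ltry// /P.
- by rewrite !subrr normr0 mulr0 addr0.
- move=> r r0 _ Pr; have a2 : 0 < a / 2 by rewrite divr_gt0.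
  apply: (filterS2 _ _ (ud _ r0 _ a2) (vd _ r0 _ a2)) => s Hu Hv rs _.
  have s0 : 0 <= s by rewrite (le_trans r0)// ltW.
  have sr : 0 <= s - r by rewrite subr_ge0 ltW.
  have {}Hu := Hu s0; have {}Hv := Hv s0.
  rewrite (ger0_norm sr) in Hu Hv.
  have Hus : `|u s - u r| <= a / 2 * (s - r) + (s - r) * dv r.
    rewrite -(subrK ((s - r) *: du r) (u s - u r)) (le_trans (ler_normD _ _))//.
    by rewrite lerD// normrZ (ger0_norm sr) ler_wpM2l// duv.
  move: Hv; rewrite ler_norml => /andP[Hv _].
  have := ler_distD (u r) (u s) (u 0).
  rewrite /GRing.scale/= in Hv; lra.
- move=> r r0 _ Ps; rewrite leNgt; apply/negP => nP.
  (* [g] is the amount of the violation at [r]. Moving [u] and [v] by at most [g / 4] each leaves a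
     violation at some earlier [s], where the inequality is known. *)
  pose g := `|u r - u 0| - (v r - v 0 + a * r).
  have g0 : 0 < g by rewrite subr_gt0.
  have g4 : 0 < g / 4 by rewrite divr_gt0.
  have Hu := hasderiv_continuous (ud _ (ltW r0)) g4.
  have Hv := hasderiv_continuous (vd _ (ltW r0)) g4.
  have [s [s0 sr Hus Hvs]] : exists s,
      [/\ 0 < s, s < r, 0 <= s -> `|u s - u r| <= g / 4
        & 0 <= s -> `|v s - v r| <= g / 4].
    apply: (@filter_ex _ (r^'-)); near=> s; split.
    - by near: s; exact: nbhs_left_gt.
    - by near: s; exact: nbhs_left_lt.
    - by near: s; exact: (cvg_within _ Hu).
    - by near: s; exact: (cvg_within _ Hv).
  have := Ps s; rewrite (ltW s0) sr => /(_ isT) {}Ps.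
  have {}Hus := Hus (ltW s0); have {}Hvs := Hvs (ltW s0).
  have := ler_distD (u s) (u r) (u 0); rewrite (distrC (u r) (u s)).
  move: Hvs; rewrite ler_norml => /andP[_ Hvs].
  have : a * s <= a * r by rewrite ler_wpM2l// ltW.
  rewrite /g in Hus Hvs; move: (g0); rewrite /g; lra.
Unshelve. all: by end_near. Qed.

End Derivative.

(** * Global Picard theorem *)

Section Antiderivative.
Context {R : realType}.

(* Stands in for a vector-valued integral: the Picard iteration only needs
   primitives, and mean_value_le supplies the estimates. *)
Definition antiderivable (E : normedModType R) := forall G : R -> E,
  continuous G -> exists H : R -> E,
    H 0 = 0 /\ forall t, 0 <= t -> hasderiv [set s | 0 <= s] H t (G t).

(** The only form of completeness that the iteration uses. The rate is included because the limit
    has to be compared with each single iterate. *)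
Definition geometric_complete (E : normedModType R) := forall (u : nat -> E) C,
  (forall k, `|u k.+1 - u k| <= C / 2 ^+ k) ->
  exists l, forall k, `|l - u k| <= 2 * C / 2 ^+ k.

Lemma antiderivable_real : antiderivable R^o.
Proof.
move=> G Gc.
(* Starting the integral at -1 makes every [t >= 0], including 0, an interior point, so the
   two-sided fundamental theorem applies. *)
pose F (x : R) := \int[lebesgue_measure]_(t in [set` `[-1, x]]) G t.
exists (fun x => F x - F 0); split; first by rewrite subrr.
move=> t t0; rewrite -[G t]subr0; apply: hasderiv_sub; last exact: hasderiv_cst.
apply: is_derive_hasderiv.
have t1 : t < t + 1 by lra.
have Gi : lebesgue_measure.-integrable [set` `[-1, t + 1]] (EFin \o G).
  apply: continuous_compact_integrable; first exact: segment_compact.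
  exact: continuous_subspaceT.
have [//||dF F'] := @continuous_FTC1_closed R G (-1) t (t + 1) t1 Gi.
- lra.
- exact: Gc.
- by apply: DeriveDef; rewrite -?derive1E.
Qed.

Lemma ler_mx_coord m n (M : 'M[R]_(m, n)) c : 0 <= c ->
  (forall i j, `|M i j| <= c) -> `|M| <= c.
Proof.
by move=> c0 Mc; rewrite /Num.Def.normr/= mx_normrE; apply: bigmax_le => // -[].
Qed.

Lemma coord_ler_norm m n (M : 'M[R]_(m, n)) i j : `|M i j| <= `|M|.
Proof.
by rewrite {2}/Num.Def.normr/= mx_normrE (le_bigmax _ (fun p => `|M p.1 p.2|) (i, j)).
Qed.

Lemma antiderivable_rV n : antiderivable 'rV[R]_n.
Proof.
move=> G Gc.
have /choice [H Hh] i : exists H : R -> R^o, H 0 = 0 /\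
    forall t, 0 <= t -> hasderiv [set s | 0 <= s] H t (G t 0 i).
  apply: (@antiderivable_real (fun t => G t 0 i)) => t.
  exact: (continuous_comp (Gc t) (@coord_continuous _ _ _ 0 i _)).
exists (fun t => \row_i H i t); split.
  by apply/rowP => i; rewrite !mxE (Hh i).1.
move=> t t0 e e0.
have : \forall s \near t, forall i, 0 <= s ->
    `|H i s - H i t - (s - t) *: G t 0 i| <= e * `|s - t|.
  near=> s => i; move: i; near: s.
  by apply: filter_forall => i; exact: (Hh i).2.
apply: filterS => s Hs s0; apply: ler_mx_coord => [|i j].
  by rewrite mulr_ge0// ltW.
by rewrite ord1 !mxE Hs.
Unshelve. all: by end_near. Qed.

Lemma antiderivable_prod (E F : normedModType R) :
  antiderivable E -> antiderivable F -> antiderivable (E * F)%type.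
Proof.
move=> aE aF G Gc.
have [|H1 [H10 H1d]] := aE (fun t => (G t).1).
  by move=> t; apply: (@continuous_comp _ _ _ G fst); [exact: Gc|exact: cvg_fst].
have [|H2 [H20 H2d]] := aF (fun t => (G t).2).
  by move=> t; apply: (@continuous_comp _ _ _ G snd); [exact: Gc|exact: cvg_snd].
exists (fun t => (H1 t, H2 t)); split; first by rewrite H10 H20.
move=> t t0 e e0; apply: (filterS2 _ _ (H1d _ t0 _ e0) (H2d _ t0 _ e0)) => s Hs1 Hs2 s0.
by rewrite prod_normE/= ge_max Hs1// Hs2.
Qed.

Lemma geometric_to0 (C e : R) : 0 < e -> exists k, C / 2 ^+ k <= e.
Proof.
move=> e0.
have : C / 2 ^+ k @[k --> \oo] --> 0.
  rewrite -[0](mulr0 C); apply: cvgMr.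
  under eq_fun do rewrite -exprVn.
  by apply: cvg_expr; rewrite ger0_norm ?invr_ge0// invf_lt1// ltr1n.
move=> /cvgrPdist_le /(_ _ e0)[k _ /(_ k)] /=; rewrite leqnn sub0r normrN => /(_ isT).
by move=> H; exists k; rewrite (le_trans (ler_norm _)).
Qed.

Lemma geometric_complete_real : geometric_complete R^o.
Proof.
move=> u C uC.
have C0 : 0 <= C by have := uC 0%N; rewrite expr0 divr1; apply: le_trans.
(* The partial geometric sum is kept in exact telescoped form, which lets the induction on [j]
   close. *)
have H j k : `|u (k + j)%N - u k| <= 2 * C / 2 ^+ k - 2 * C / 2 ^+ (k + j).
  elim: j => [|j IH]; first by rewrite addn0 !subrr normr0.
  rewrite addnS; have := uC (k + j)%N.
  have := ler_distD (u (k + j)%N) (u (k + j).+1) (u k).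
  rewrite exprS invfM mulrA [2 * C]mulrC mulfK// in IH *; move: IH.
  have -> : C * 2 / 2 ^+ (k + j) = 2 * (C / 2 ^+ (k + j)).
    by rewrite mulrAC mulrC.
  lra.
have Hk j k : `|u (k + j)%N - u k| <= 2 * C / 2 ^+ k.
  by rewrite (le_trans (H j k))// gerBl divr_ge0// ?mulr_ge0// exprn_ge0.
have /cauchy_cvgP uc : cauchy (u @ \oo).
  apply: cauchy_exP => e e0.
  have e2 : 0 < e / 2 by rewrite divr_gt0.
  have [k ke] := geometric_to0 (2 * C) e2.
  exists (u k); exists k => // j /= kj; rewrite /ball/= distrC -(subnKC kj).
  by rewrite (le_lt_trans (Hk _ _))// (le_lt_trans ke)// ltr_pdivrMr// ltr_pMr// ltr1n.
exists (lim (u @ \oo)) => k.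
have : `|u j - u k| @[j --> \oo] --> `|lim (u @ \oo) - u k|.
  by apply: cvg_norm; apply: cvgB => //; exact: cvg_cst.
move=> /cvgr_to_le; apply.
by exists k => // j /= kj; rewrite -(subnKC kj).
Qed.

Lemma geometric_complete_rV n : geometric_complete 'rV[R]_n.
Proof.
move=> u C uC.
have C0 : 0 <= C by have := uC 0%N; rewrite expr0 divr1; apply: le_trans.
have /choice [l Hl] i : exists l : R^o, forall k, `|l - u k 0 i| <= 2 * C / 2 ^+ k.
  apply: geometric_complete_real => k; apply: le_trans (uC k).
  by have := coord_ler_norm (u k.+1 - u k) 0 i; rewrite !mxE.
exists (\row_i l i) => k; apply: ler_mx_coord => [|i j].
  by rewrite divr_ge0// ?mulr_ge0// exprn_ge0.
by rewrite ord1 !mxE.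
Qed.

Lemma geometric_complete_prod (E F : normedModType R) :
  geometric_complete E -> geometric_complete F -> geometric_complete (E * F)%type.
Proof.
move=> cE cF u C uC.
have [k|l1 H1] := cE (fun k => (u k).1) C.
  by apply: le_trans (uC k); rewrite prod_normE/= le_max lexx.
have [k|l2 H2] := cF (fun k => (u k).2) C.
  by apply: le_trans (uC k); rewrite prod_normE/= le_max lexx orbT.
by exists (l1, l2) => k; rewrite prod_normE/= ge_max H1 H2.
Qed.

End Antiderivative.

Section Picard.
Context {R : realType}.

Lemma hasderiv_scaled_expR (A : set R) (c a t : R) :
  hasderiv A (fun s => c * expR (a * s)) t (c * (a * expR (a * t))).
Proof.
apply: is_derive_hasderiv.
have : is_derive t 1 (fun s : R => c *: expR (a *: s)) (c *: (expR (a *: t) * (a *: 1))).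
  exact: is_deriveZ.
by rewrite /GRing.scale/= mulr1 [expR _ * a]mulrC.
Qed.

(* The weight expR (2 * L * t) makes successive Picard iterates contract by a
   factor 1/2 on the whole half-line, so no continuation argument is needed. *)
Lemma picard_global (E : normedModType R) (F : E -> E) (L : R) (w0 : E) :
  antiderivable E -> geometric_complete E -> 0 < L ->
  (forall x y, `|F x - F y| <= L * `|x - y|) ->
  exists w : R -> E, w 0 = w0 /\
    forall t, 0 <= t -> hasderiv [set s | 0 <= s] w t (F (w t)).
Proof.
move=> aE cE L0 Flip.
(* Continuity relative to the half-line: nothing is known about the iterates at negative times. *)
pose cont0 (u : R -> E) := forall t : R, 0 <= t -> forall e : R, 0 < e ->
  \forall s \near t, 0 <= s -> `|u s - u t| <= e.
(* [Phi] is the Picard operator, sending [u] to [w0] plus the primitive of [F] along [u]; outside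
   [cont0] its value is a dummy. *)
have /choice [Phi HPhi] (u : R -> E) : exists v : R -> E, cont0 u ->
    [/\ cont0 v, v 0 = w0 &
        forall t, 0 <= t -> hasderiv [set s | 0 <= s] v t (F (u t))].
  have [uc|nuc] := pselect (cont0 u); last by exists u.
  (* Reflecting negative times yields an integrand continuous on the whole line, as [antiderivable]
     demands, and changes nothing for [t >= 0]. *)
  have Gc : continuous (fun t : R => F (u `|t|)).
    move=> t; apply/cvgrPdist_le => e e0.
    have eL : 0 < e / L by rewrite divr_gt0.
    have H : \forall s \near t, 0 <= `|s| -> `|u `|s| - u `|t| | <= e / L.
      exact: (@norm_continuous _ _ t _ (uc _ (normr_ge0 t) _ eL)).
    near=> s; rewrite (le_trans (Flip _ _))// distrC mulrC -ler_pdivlMr//.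
    by move: (normr_ge0 s); near: s.
  have [H [H0 Hd]] := aE _ Gc.
  have Hd' t : 0 <= t -> hasderiv [set s | 0 <= s] (fun s => w0 + H s) t (F (u t)).
    by move=> t0; apply: hasderivDc; have := Hd _ t0; rewrite ger0_norm.
  exists (fun s => w0 + H s) => _; split => //; last by rewrite H0 addr0.
  by move=> t t0; exact: hasderiv_continuous (Hd' _ t0).
pose q k := iter k Phi (fun=> w0).
have qc k : cont0 (q k).
  elim: k => [|k IH]; last by have [] := HPhi _ IH.
  by move=> t t0 e e0; near=> s => _; rewrite /q/= subrr normr0 ltW.
have q0 k : q k 0 = w0 by case: k => //= k; have [] := HPhi _ (qc k).
have qd k t : 0 <= t -> hasderiv [set s | 0 <= s] (q k.+1) t (F (q k t)).
  by have [_ _] := HPhi _ (qc k); apply.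
(* Chosen so that [M * expR (2 * L * t)] has derivative at least the norm of [F w0], the speed of
   the first iterate. *)
pose M := `|F w0| / (2 * L).
have L2 : 0 < 2 * L by rewrite mulr_gt0.
have M0 : 0 <= M by rewrite divr_ge0// ltW.
have p2 k : 0 < 2 ^+ k :> R by rewrite exprn_gt0.
have bound (u v : R -> E) (du dv : R -> E) k :
    u 0 = v 0 ->
    (forall t, 0 <= t -> hasderiv [set s | 0 <= s] u t (du t)) ->
    (forall t, 0 <= t -> hasderiv [set s | 0 <= s] v t (dv t)) ->
    (forall t, 0 <= t ->
      `|du t - dv t| <= M / 2 ^+ k * (2 * L * expR (2 * L * t))) ->
    forall t, 0 <= t -> `|u t - v t| <= M / 2 ^+ k * expR (2 * L * t).
  move=> uv0 ud vd duv t t0.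
  have := mean_value_le (fun r r0 => hasderiv_sub (ud r r0) (vd r r0))
    (fun r _ => hasderiv_scaled_expR _ (M / 2 ^+ k) (2 * L) r) duv t0.
  rewrite uv0 subrr subr0 => /le_trans; apply.
  by rewrite gerBl mulr_ge0// ?expR_ge0// divr_ge0// ltW.
have qq k : forall t, 0 <= t -> `|q k.+1 t - q k t| <= M / 2 ^+ k * expR (2 * L * t).
  elim: k => [|k IH].
    apply: (bound _ _ (fun=> F w0) (fun=> 0)); rewrite ?q0//.
    - exact: (qd 0%N).
    - by move=> t t0; exact: hasderiv_cst.
    - move=> t t0; rewrite subr0 expr0 divr1 /M mulrA divfK ?gt_eqF//.
      by rewrite ler_peMr// -[leLHS]expR0 ler_expR mulr_ge0// ltW.
  apply: (bound _ _ (fun t => F (q k.+1 t)) (fun t => F (q k t))); rewrite ?q0//.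
  - exact: qd.
  - exact: qd.
  - move=> t t0; rewrite (le_trans (Flip _ _))//.
    rewrite (le_trans (ler_wpM2l (ltW L0) (IH _ t0)))// exprS invfM.
    by rewrite le_eqVlt; apply/orP; left; apply/eqP; field; rewrite gt_eqF.
have /choice [w Hw] t : exists l, 0 <= t ->
    forall k, `|l - q k t| <= 2 * (M * expR (2 * L * t)) / 2 ^+ k.
  have [t0|] := leP 0 t; last by exists 0.
  have [k|l Hl] := cE (fun k => q k t) (M * expR (2 * L * t)).
    by rewrite mulrAC qq.
  by exists l.
have wc : cont0 w.
  move=> t t0 e e0.
  have e3 : 0 < e / 3 by rewrite divr_gt0.
  (* The weight increases with time, so an index good at [t + 1] is good for all [s] in
     [[0, t + 1]]: convergence is locally uniform and the limit inherits continuity. *)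
  have [k ke] := geometric_to0 (2 * (M * expR (2 * L * (t + 1)))) e3.
  have H s : 0 <= s -> s <= t + 1 -> `|w s - q k s| <= e / 3.
    move=> s0 st; rewrite (le_trans (Hw _ s0 k))// (le_trans _ ke)//.
    apply: ler_wpM2r; first by rewrite invr_ge0 ltW.
    by rewrite ler_pM2l// ler_wpM2l// ler_expR ler_wpM2l// ltW.
  apply: (filterS2 _ _ (near_ball t 1 ltr01) (qc k _ t0 _ e3)) => s.
  rewrite /ball/= ltr_distlC => /andP[_ st] Hs s0.
  have {}Hs := Hs s0; have H1 := H _ s0 (ltW st).
  have H2 : `|w t - q k t| <= e / 3 by apply: H => //; lra.
  have := ler_distD (q k s) (w s) (w t).
  have := ler_distD (q k t) (q k s) (w t).
  rewrite (distrC (q k t) (w t)); lra.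
exists (Phi w); have [_ W0 Wd] := HPhi _ wc; split => // t t0.
(* [w] is a fixed point: [Phi w t] and [w t] are both within [M / 2 ^+ k] times the weight of
   [q k.+1 t], for every [k]. *)
suff -> : Phi w t = w t by exact: Wd.
apply/eqP; rewrite -subr_eq0 -normr_le0; apply/ler_addgt0Pr => e e0.
rewrite add0r.
have [k ke] := geometric_to0 (2 * (M * expR (2 * L * t))) e0.
have H : `|Phi w t - q k.+1 t| <= M / 2 ^+ k * expR (2 * L * t).
  apply: (bound _ _ (fun t => F (w t)) (fun t => F (q k t))) => //.
  - by rewrite W0 q0.
  - exact: qd.
  - move=> r r0; rewrite (le_trans (Flip _ _))//.
    rewrite (le_trans (ler_wpM2l (ltW L0) (Hw _ r0 _)))//.
    by rewrite le_eqVlt; apply/orP; left; apply/eqP; field; rewrite gt_eqF.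
have := Hw _ t0 k.+1; have := ler_distD (q k.+1 t) (Phi w t) (w t).
rewrite (distrC (q k.+1 t)) exprS invfM.
have -> : 2 * (M * expR (2 * L * t)) * (2^-1 / 2 ^+ k) = M / 2 ^+ k * expR (2 * L * t).
  by field; rewrite gt_eqF.
move: ke; have -> : 2 * (M * expR (2 * L * t)) / 2 ^+ k = 2 * (M / 2 ^+ k * expR (2 * L * t)).
  by field; rewrite gt_eqF.
lra.
Unshelve. all: by end_near. Qed.

End Picard.

(** * Lipschitz extension *)

Section LipschitzExtension.
Context {R : realType} (V : normedModType R).

Lemma lipschitz_extension_real (C : set V) (p : V -> R) (L : R) :
  C !=set0 -> 0 <= L ->
  (forall x y, C x -> C y -> `|p x - p y| <= L * `|x - y|) ->
  exists q : V -> R, (forall x, C x -> q x = p x) /\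
    forall x y, `|q x - q y| <= L * `|x - y|.
Proof.
move=> [x0 Cx0] L0 pL.
(* McShane's extension: q x = sup_(y in C) (p y - L |x - y|). *)
pose S x := [set p y - L * `|x - y| | y in C].
have Lxy (x y z : V) : L * `|x - z| <= L * `|x - y| + L * `|y - z|.
  by rewrite -mulrDr ler_wpM2l// ler_distD.
have pD y z : C y -> C z -> p y - p z <= L * `|y - z|.
  by move=> Cy Cz; apply: le_trans (pL _ _ Cy Cz); exact: ler_norm.
have S0 x : S x !=set0 by exists (p x0 - L * `|x - x0|); exists x0.
have Sub x : has_ubound (S x).
  exists (p x0 + L * `|x - x0|) => _ [y Cy <-].
  by have := pD _ _ Cy Cx0; have := Lxy y x x0; rewrite (distrC y x); lra.
exists (fun x => sup (S x)); split=> [x Cx|x y].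
  apply/eqP; rewrite eq_le; apply/andP; split.
    apply: ge_sup => // _ [y Cy <-].
    by have := pD _ _ Cy Cx; rewrite (distrC y x); lra.
  by apply: ub_le_sup => //; exists x => //; rewrite subrr normr0 mulr0 subr0.
have H (a b : V) : sup (S a) - sup (S b) <= L * `|a - b|.
  rewrite lerBlDr; apply: ge_sup => // _ [c Cc <-].
  have : p c - L * `|b - c| <= sup (S b) by apply: ub_le_sup => //; exists c.
  by have := Lxy b a c; rewrite (distrC b a); lra.
by rewrite ler_norml H andbT; have := H y x; rewrite (distrC y x); lra.
Qed.

(** Coordinatewise extension keeps the constant [L] because the norm on the target is the sup norm.
    An empty [C] is treated apart, since the real case needs a base point. *)
Lemma lipschitz_extension m (C : set V) (p : V -> 'rV[R]_m) (L : R) :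
  0 <= L -> (forall x y, C x -> C y -> `|p x - p y| <= L * `|x - y|) ->
  exists q : V -> 'rV[R]_m, (forall x, C x -> q x = p x) /\
    forall x y, `|q x - q y| <= L * `|x - y|.
Proof.
move=> L0 pL; have [->|C0] := eqVneq C set0.
  exists (fun=> 0); split=> // x y; rewrite subrr normr0 mulr_ge0//.
move/set0P : C0 => C0.
have /choice [q Hq] i : exists q : V -> R, (forall x, C x -> q x = p x 0 i) /\
    forall x y, `|q x - q y| <= L * `|x - y|.
  apply: (lipschitz_extension_real C0 L0) => x y Cx Cy.
  apply: le_trans (pL _ _ Cx Cy).
  by have := coord_ler_norm (p x - p y) 0 i; rewrite !mxE.
exists (fun x => \row_i q i x); split=> [x Cx|x y].
  by apply/rowP => i; rewrite mxE (Hq i).1.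
apply: ler_mx_coord => [|i j]; first by rewrite mulr_ge0.
by rewrite ord1 !mxE (Hq j).2.
Qed.

End LipschitzExtension.

(** * Invariance of the superlevel set of V *)

Section HasDerivMore.
Context {R : realType} {E : normedModType R}.
Implicit Types (A : set R) (u : R -> E).

Lemma hasderiv_lip A u t d e : 0 < e -> hasderiv A u t d ->
  \forall s \near t, A s -> `|u s - u t| <= (`|d| + e) * `|s - t|.
Proof.
move=> e0 /(_ _ e0); apply: filterS => s Hs /Hs {}Hs.
rewrite -(subrK ((s - t) *: d) (u s - u t)) (le_trans (ler_normD _ _))//.
by rewrite (le_trans (lerD Hs (lexx _)))// normrZ; lra.
Qed.

Lemma hasderiv_near A u t d (P : E -> Prop) : hasderiv A u t d ->
  (\forall x \near u t, P x) -> \forall s \near t, A s -> P (u s).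
Proof.
move=> ud /nbhs_ballP[e /= e0 eP].
have e2 : 0 < e / 2 by rewrite divr_gt0.
apply: filterS (hasderiv_continuous ud e2) => s Hs /Hs {}Hs.
by apply: eP; rewrite -ball_normE/= distrC (le_lt_trans Hs)//; lra.
Qed.

Lemma hasderiv_comp A u t d (h : E -> R) (dh : E -> R) (M : R) :
  (forall v w, dh (v - w) = dh v - dh w) -> (forall a v, dh (a *: v) = a * dh v) ->
  (forall v, `|dh v| <= M * `|v|) ->
  (forall e, 0 < e ->
    \forall y \near u t, `|h y - h (u t) - dh (y - u t)| <= e * `|y - u t|) ->
  hasderiv A u t d -> hasderiv A (fun s => h (u s)) t (dh d).
Proof.
move=> dhB dhZ dhM hd ud e e0.
have d1 : 0 < `|d| + 1 by rewrite ltr_wpDl.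
have M1 : 0 < `|M| + 1 by rewrite ltr_wpDl.
(* [e1] controls the remainder of [h], scaled by the local speed of [u]; [e2] controls the remainder
   of [u], scaled by the bound on [dh]. *)
pose e1 := e / 2 / (`|d| + 1); pose e2 := e / 2 / (`|M| + 1).
have e10 : 0 < e1 by rewrite !divr_gt0.
have e20 : 0 < e2 by rewrite !divr_gt0.
near=> s => As.
have H1 : `|u s - u t| <= (`|d| + 1) * `|s - t|.
  by move: As; near: s; exact: hasderiv_lip.
have H2 : `|u s - u t - (s - t) *: d| <= e2 * `|s - t|.
  by move: As; near: s; exact: ud.
have H3 : `|h (u s) - h (u t) - dh (u s - u t)| <= e1 * `|u s - u t|.
  by move: As; near: s; exact: (hasderiv_near ud (hd _ e10)).
rewrite /GRing.scale/= -dhZ.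
have -> : h (u s) - h (u t) - dh ((s - t) *: d) =
  (h (u s) - h (u t) - dh (u s - u t)) + dh (u s - u t - (s - t) *: d).
  by rewrite [dh (u s - u t - _)]dhB; ring.
rewrite (le_trans (ler_normD _ _))// (le_trans (lerD H3 (dhM _)))//.
have : e1 * `|u s - u t| <= e / 2 * `|s - t|.
  rewrite (le_trans (ler_wpM2l (ltW e10) H1))// mulrA ler_wpM2r// /e1 divfK//.
have : M * `|u s - u t - (s - t) *: d| <= e / 2 * `|s - t|.
  rewrite (le_trans (ler_wpM2r _ (ler_norm M)))//.
  rewrite (@le_trans _ _ ((`|M| + 1) * `|u s - u t - (s - t) *: d|))//.
    by rewrite ler_wpM2r// lerDl.
  rewrite (le_trans (ler_wpM2l (ltW M1) H2))// mulrA ler_wpM2r// /e2 mulrC divfK//.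
lra.
Unshelve. all: by end_near. Qed.

End HasDerivMore.

(** * Barrier argument in abstract normed spaces *)

Section Barrier.
Context {R : realType} (X Z : normedModType R).
Variables (f : X -> Z -> X) (g : Z -> X -> Z) (zs : X -> Z).
Variables (h : X -> R) (dh : X -> X -> R) (U : Z -> R) (dU : Z -> Z -> R).
Variables (K M L F0 La b1 b2 b3 b4 eta : R).
Hypotheses (K0 : 0 <= K) (L0 : 0 <= L) (La0 : 0 <= La).
Hypotheses (b10 : 0 < b1) (b20 : 0 < b2) (b40 : 0 < b4).
Hypothesis (M0 : 0 <= M) (eta0 : 0 < eta).
Hypothesis dhB : forall x v w, dh x (v - w) = dh x v - dh x w.
Hypothesis dhZ : forall x a v, dh x (a *: v) = a * dh x v.
Hypothesis dUB : forall x v w, dU x (v - w) = dU x v - dU x w.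
Hypothesis dUZ : forall x a v, dU x (a *: v) = a * dU x v.
Hypothesis h_cont : continuous h.
Hypothesis U_cont : continuous U.
Hypothesis h_diff : forall x, 0 <= h x -> forall e, 0 < e ->
  \forall y \near x, `|h y - h x - dh x (y - x)| <= e * `|y - x|.
Hypothesis U_diff : forall x e, 0 < e ->
  \forall y \near x, `|U y - U x - dU x (y - x)| <= e * `|y - x|.
Hypothesis dhM : forall x v, 0 <= h x -> `|dh x v| <= M * `|v|.
Hypothesis dUM : forall z v, `|dU z v| <= b4 * `|z| * `|v|.
Hypothesis zs_lip : forall x, 0 <= h x ->
  \forall y \near x, 0 <= h y -> `|zs y - zs x| <= K * `|y - x|.
Hypothesis f_lip : forall x z z', 0 <= h x -> `|f x z - f x z'| <= L * `|z - z'|.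
Hypothesis f_bound : forall x, 0 <= h x -> `|f x (zs x)| <= F0.
Hypothesis barrier : forall x, 0 <= h x ->
  eta - La * h x <= dh x (f x (zs x)).
Hypothesis U_bounds : forall z, b1 * `|z| ^+ 2 <= U z <= b2 * `|z| ^+ 2.
Hypothesis U_decrease : forall z x, 0 <= h x ->
  dU z (g (z + zs x) x) <= - b3 * `|z| ^+ 2.

Let V x z := h x - U (z - zs x).
(** Coefficients of [r] and [r ^+ 2] among the adverse terms: [M * L] comes from [z] being off
    equilibrium in the slow dynamics, [La * b2] from [h <= b2 * r ^+ 2], and the products with
    [b4 * K] from the motion of the equilibrium at speed at most [F0 + L * r]. *)
Let c1 := M * L + b4 * K * F0.
Let c2 := La * b2 + b4 * K * L.

(* On the boundary V = 0 this is the lower bound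
   eta - c1 r + (b3 / eps - c2) r^2 for the derivative of V along a solution,
   with r = |z - zs x|; it is positive once b3 / eps - c2 > c1^2 / eta. *)
Lemma boundary_drift eps x z : 0 < eps < b3 / (c2 + c1 ^+ 2 / eta + 1) ->
  0 <= h x -> V x z = 0 ->
  0 < dh x (f x z) - dU (z - zs x) (eps^-1 *: g z x)
      - b4 * `|z - zs x| * K * `|f x z|.
Proof.
move=> /andP[e0 ee] hx /eqP; rewrite subr_eq0 => /eqP hU.
set r := `|z - zs x|; have r0 : 0 <= r by exact: normr_ge0.
have c20 : 0 <= c2 by rewrite addr_ge0// !mulr_ge0// ltW.
have c1e : 0 <= c1 ^+ 2 / eta by rewrite divr_ge0 ?sqr_ge0// ltW.
have fz : `|f x z| <= F0 + L * r.
  rewrite -(subrK (f x (zs x)) (f x z)) (le_trans (ler_normD _ _))// addrC.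
  by rewrite lerD ?f_bound ?f_lip.
have df : dh x (f x (zs x)) - M * L * r <= dh x (f x z).
  have : `|dh x (f x z - f x (zs x))| <= M * L * r.
    by rewrite (le_trans (dhM _ hx))// -mulrA ler_wpM2l// f_lip.
  by rewrite dhB ler_norml => /andP[]; lra.
have dUg : dU (z - zs x) (eps^-1 *: g z x) <= - (b3 / eps) * r ^+ 2.
  rewrite dUZ; have := U_decrease (z - zs x) hx; rewrite subrK -/r => H.
  have ei : 0 <= eps^-1 by rewrite invr_ge0 ltW.
  by have := ler_wpM2l ei H; lra.
have hb : h x <= b2 * r ^+ 2 by rewrite hU; have /andP[] := U_bounds (z - zs x).
have := barrier hx.
have : La * h x <= La * (b2 * r ^+ 2) by rewrite ler_wpM2l.
have : b4 * r * K * `|f x z| <= b4 * r * K * (F0 + L * r).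
  by rewrite ler_wpM2l// !mulr_ge0// ltW.
have be : c2 + c1 ^+ 2 / eta + 1 <= b3 / eps.
  move: ee; rewrite ltr_pdivlMr; last lra.
  by rewrite ler_pdivlMr// mulrC => /ltW.
have : (c2 + c1 ^+ 2 / eta + 1) * r ^+ 2 <= b3 / eps * r ^+ 2.
  by rewrite ler_wpM2r// sqr_ge0.
have : 0 < eta - c1 * r + c1 ^+ 2 / eta * r ^+ 2.
  (* The two squares cannot vanish together: if [c1 * r = 0], the first one is [eta ^+ 2]. *)
  have -> : eta - c1 * r + c1 ^+ 2 / eta * r ^+ 2 =
    eta^-1 * ((eta - c1 * r / 2) ^+ 2 + 3 / 4 * (c1 * r) ^+ 2).
    by field; rewrite gt_eqF.
  rewrite mulr_gt0 ?invr_gt0//.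
  have [->|cr] := eqVneq (c1 * r) 0.
    by rewrite mul0r subr0 expr0n/= mulr0 addr0 exprn_gt0.
  by rewrite ltr_wpDl ?sqr_ge0// mulr_gt0// exprn_even_gt0.
have := sqr_ge0 r.
rewrite /c1 /c2; lra.
Qed.

Let S x z := 0 <= h x /\ 0 <= V x z.

Section Trajectory.
Variables (A : set R) (w1 : R -> X) (w2 : R -> Z) (t : R) (v1 : X) (v2 : Z).
Hypotheses (w1d : hasderiv A w1 t v1) (w2d : hasderiv A w2 t v2).
Hypothesis hx : 0 <= h (w1 t).

Let zeta s := w2 s - zs (w1 s).
Let Q := (`|v2| + 1) + K * (`|v1| + 1).

Let Q0 : 0 <= Q.
Proof. by rewrite addr_ge0// ?mulr_ge0// addr_ge0. Qed.

Let zetaB s : zeta s - zeta t = (w2 s - w2 t) - (zs (w1 s) - zs (w1 t)).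
Proof. by rewrite /zeta opprD addrACA -opprD. Qed.

Lemma zs_traj e : 0 < e -> \forall s \near t, A s -> 0 <= h (w1 s) ->
  `|zs (w1 s) - zs (w1 t)| <= K * ((`|v1| + e) * `|s - t|).
Proof.
move=> e0; apply: (filterS2 _ _ (hasderiv_near w1d (zs_lip hx)) (hasderiv_lip e0 w1d)).
by move=> s H1 H2 As hs; rewrite (le_trans (H1 As hs))// ler_wpM2l// H2.
Qed.

Lemma zeta_traj : \forall s \near t, A s -> 0 <= h (w1 s) ->
  `|zeta s - zeta t| <= Q * `|s - t|.
Proof.
apply: (filterS2 _ _ (zs_traj ltr01) (hasderiv_lip ltr01 w2d)) => s H1 H2 As hs.
rewrite zetaB (le_trans (ler_normB _ _))// /Q mulrDl -mulrA.
by rewrite lerD ?H1 ?H2.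
Qed.

Lemma zeta_near (P : Z -> Prop) : (\forall z \near zeta t, P z) ->
  \forall s \near t, A s -> 0 <= h (w1 s) -> P (zeta s).
Proof.
move=> /nbhs_ballP[e /= e0 eP].
have eQ : 0 < e / (Q + 1) by rewrite divr_gt0// ltr_wpDl.
apply: (filterS2 _ _ zeta_traj (near_ball t _ eQ)) => s Hs ts As hs.
apply: eP; rewrite -ball_normE/= distrC (le_lt_trans (Hs As hs))//.
move: ts; rewrite /ball/= distrC ltr_pdivlMr; last by rewrite ltr_wpDl.
by apply: le_lt_trans; rewrite mulrC ler_wpM2l// lerDl.
Qed.

(** [zeta] need not be differentiable, since [zs] is only Lipschitz at each point relative to the
    set [0 <= h]. The increment is therefore bounded from above: [w2] contributes through its
    derivative, the equilibrium through its speed [K * |v1|] times the gradient bound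
    [b4 * |zeta t|]. *)
Lemma U_traj e : 0 < e -> \forall s \near t, t < s -> A s -> 0 <= h (w1 s) ->
  U (zeta s) - U (zeta t) <=
  (s - t) * (dU (zeta t) v2 + b4 * `|zeta t| * K * `|v1| + e).
Proof.
move=> e0; set r := `|zeta t|.
have r0 : 0 <= r by exact: normr_ge0.
have b4r : 0 <= b4 * r by rewrite mulr_ge0// ltW.
have B0 : 0 < b4 * r * (1 + K) + 1 by rewrite ltr_wpDl// mulr_ge0// addr_ge0.
have Q1 : 0 < Q + 1 by rewrite ltr_wpDl.
(* [e1] pays for the remainder of [U], [e2] for the remainder of [w2] and the excess speed of [w1];
   each group costs at most [e / 2 * (s - t)]. *)
pose e1 := e / 2 / (Q + 1); pose e2 := e / 2 / (b4 * r * (1 + K) + 1).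
have e10 : 0 < e1 by rewrite !divr_gt0.
have e20 : 0 < e2 by rewrite !divr_gt0.
near=> s => ts As hs.
have st : 0 <= s - t by rewrite subr_ge0 ltW.
have H1 : `|zs (w1 s) - zs (w1 t)| <= K * ((`|v1| + e2) * (s - t)).
  by rewrite -[s - t]ger0_norm//; move: As hs; near: s; exact: zs_traj.
have H2 : `|zeta s - zeta t| <= Q * (s - t).
  by rewrite -[s - t]ger0_norm//; move: As hs; near: s; exact: zeta_traj.
have H3 : `|w2 s - w2 t - (s - t) *: v2| <= e2 * (s - t).
  by rewrite -[X in _ * X]ger0_norm//; move: As; near: s; exact: w2d.
have H4 : `|U (zeta s) - U (zeta t) - dU (zeta t) (zeta s - zeta t)| <=
    e1 * `|zeta s - zeta t|.
  by move: As hs; near: s; exact: zeta_near (U_diff _ e10).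
have H5 : `|dU (zeta t) (w2 s - w2 t) - (s - t) * dU (zeta t) v2| <= b4 * r * (e2 * (s - t)).
  by rewrite -dUZ -dUB (le_trans (dUM _ _))// ler_wpM2l.
have H6 : `|dU (zeta t) (zs (w1 s) - zs (w1 t))| <= b4 * r * (K * ((`|v1| + e2) * (s - t))).
  by rewrite (le_trans (dUM _ _))// ler_wpM2l.
have H7 : e1 * `|zeta s - zeta t| <= e / 2 * (s - t).
  have H : e1 * `|zeta s - zeta t| <= e1 * ((Q + 1) * (s - t)).
    by rewrite ler_pM2l// (le_trans H2)// ler_wpM2r// lerDl.
  by rewrite (le_trans H)// mulrA /e1 divfK// gt_eqF.
have H8 : b4 * r * (e2 * (s - t)) + b4 * r * (K * (e2 * (s - t))) <= e / 2 * (s - t).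
  have -> : b4 * r * (e2 * (s - t)) + b4 * r * (K * (e2 * (s - t))) =
    e2 * (s - t) * (b4 * r * (1 + K)) by ring.
  have H : e2 * (s - t) * (b4 * r * (1 + K)) <= e2 * (s - t) * (b4 * r * (1 + K) + 1).
    by rewrite ler_wpM2l ?lerDl// mulr_ge0// ltW.
  by rewrite (le_trans H)// mulrAC /e2 divfK// gt_eqF.
move: H4 H5 H6; rewrite zetaB dUB !ler_norml.
move=> /andP[_ H4] /andP[_ H5] /andP[H6 _].
rewrite zetaB in H7; lra.
Unshelve. all: by end_near. Qed.

End Trajectory.

(** First [h] is kept nonnegative, because the estimate for [V] at time [s] needs [0 <= h (w1 s)];
    then [V] is treated, according to whether it vanishes or is positive at [t]. *)
Lemma superlevel_right eps (A : set R) w1 w2 t :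
  0 < eps < b3 / (c2 + c1 ^+ 2 / eta + 1) -> S (w1 t) (w2 t) ->
  hasderiv A w1 t (f (w1 t) (w2 t)) ->
  hasderiv A w2 t (eps^-1 *: g (w2 t) (w1 t)) ->
  \forall s \near t, t < s -> A s -> S (w1 s) (w2 s).
Proof.
move=> eps0 [hx Vx] w1d w2d.
set v1 := f _ _ in w1d; set v2 := _ *: _ in w2d.
have hd : hasderiv A (fun s => h (w1 s)) t (dh (w1 t) v1).
  apply: hasderiv_comp w1d; [exact: dhB|exact: dhZ|move=> v; exact: dhM|exact: h_diff].
have hs : \forall s \near t, t < s -> A s -> 0 <= h (w1 s).
  move: (hx); rewrite le_eqVlt => /predU1P[hx0|hx0]; last first.
    have h2 : 0 < h (w1 t) / 2 by rewrite divr_gt0.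
    apply: filterS (hasderiv_continuous hd h2) => s H _ As.
    by have := H As; rewrite ler_norml => /andP[]; lra.
  (* h = 0 <= V forces U = 0, so the fast state is at equilibrium. *)
  have r0 : w2 t - zs (w1 t) = 0.
    apply/eqP; rewrite -normr_eq0 -sqrf_eq0 eq_le sqr_ge0 andbT.
    rewrite -(@ler_pM2l _ b1)// mulr0.
    have /andP[+ _] := U_bounds (w2 t - zs (w1 t)).
    by move: Vx; rewrite /V -hx0; lra.
  have v1E : eta <= dh (w1 t) v1.
    have := barrier hx; rewrite -hx0 mulr0 subr0 /v1.
    by move/eqP: r0; rewrite subr_eq0 => /eqP ->.
  have eta2 : 0 < eta / 2 by rewrite divr_gt0.
  apply: filterS (hd _ eta2) => s H ts As.
  have st : 0 < s - t by rewrite subr_gt0.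
  have := H As; rewrite -hx0 subr0 (gtr0_norm st) ler_norml => /andP[+ _].
  rewrite /GRing.scale/=.
  have := ler_wpM2l (ltW st) v1E; have := mulr_gt0 st eta0; lra.
(* [V] may have no derivative along the trajectory; [D] is a lower bound for its right growth rate,
   positive by [boundary_drift] when [V = 0]. *)
pose D := dh (w1 t) v1 - dU (w2 t - zs (w1 t)) v2
  - b4 * `|w2 t - zs (w1 t)| * K * `|v1|.
have growth e : 0 < e -> \forall s \near t, t < s -> A s ->
    V (w1 t) (w2 t) + (s - t) * (D - e) <= V (w1 s) (w2 s).
  move=> e0; have e2 : 0 < e / 2 by rewrite divr_gt0.
  near=> s => ts As.
  have st : 0 < s - t by rewrite subr_gt0.
  have hws : 0 <= h (w1 s) by move: ts As; near: s.
  have HU : U (w2 s - zs (w1 s)) - U (w2 t - zs (w1 t)) <=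
    (s - t) * (dU (w2 t - zs (w1 t)) v2
      + b4 * `|w2 t - zs (w1 t)| * K * `|v1| + e / 2).
    by move: ts As hws; near: s; exact: (U_traj w1d w2d hx e2).
  have Hh : `|h (w1 s) - h (w1 t) - (s - t) *: dh (w1 t) v1| <= e / 2 * `|s - t|.
    by move: As; near: s; exact: hd.
  move: Hh; rewrite (gtr0_norm st) ler_norml => /andP[+ _].
  by rewrite /GRing.scale/= /V /D; lra.
move: (Vx); rewrite le_eqVlt => /predU1P[Vx0|Vx0].
  have D0 : 0 < D by apply: boundary_drift.
  have D2 : 0 < D / 2 by rewrite divr_gt0.
  apply: (filterS2 _ _ hs (growth _ D2)) => s H1 H2 ts As.
  split; first exact: H1.
  apply: le_trans (H2 ts As); rewrite -Vx0 add0r mulr_ge0//.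
    by rewrite subr_ge0 ltW.
  lra.
(* Here [D] may have either sign: within this time the loss, at rate at most [|D| + 1], stays below
   the initial value of [V]. *)
have VD : 0 < V (w1 t) (w2 t) / (`|D| + 1) by rewrite divr_gt0// ltr_wpDl.
apply: (filterS3 _ _ hs (growth _ ltr01) (near_ball t _ VD)) => s H1 H2 H3 ts As.
split; first exact: H1.
apply: le_trans (H2 ts As).
have st : 0 < s - t by rewrite subr_gt0.
have {}H3 : (s - t) * (`|D| + 1) < V (w1 t) (w2 t).
  by rewrite -ltr_pdivlMr ?ltr_wpDl// -(gtr0_norm st) distrC.
have : (s - t) * - D <= (s - t) * `|D| by rewrite ler_pM2l// -normrN ler_norm.
lra.
Unshelve. all: by end_near. Qed.

(** A closedness argument in two stages. [zs] is continuous only relative to [0 <= h], so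
    [0 <= h (w1 t)] must come from the continuity of [h] alone before [zeta] can be passed to the
    limit in [V]. *)
Lemma superlevel_left (A : set R) w1 w2 t v1 v2 : 0 < t ->
  (forall s, 0 <= s < t -> A s) ->
  hasderiv A w1 t v1 -> hasderiv A w2 t v2 ->
  (forall s, 0 <= s < t -> S (w1 s) (w2 s)) -> S (w1 t) (w2 t).
Proof.
move=> t0 At w1d w2d Ss.
have left (P : R -> Prop) : (\forall s \near t, A s -> P s) -> exists2 s, 0 <= s < t & P s.
  move=> HP; have : \forall s \near t^'-, 0 <= s < t /\ P s.
    near=> s.
    have s0t : 0 <= s < t.
      apply/andP; split; last by near: s; exact: nbhs_left_lt.
      by near: s; exact: nbhs_left_ge.
    split=> //; move: (At _ s0t); near: s; exact: (cvg_within _ HP).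
  by move=> /filter_ex[s []]; exists s.
have hx : 0 <= h (w1 t).
  rewrite leNgt; apply/negP => hx.
  have hneg : \forall x \near w1 t, h x < 0.
    by apply: cvgr_lt hx; exact: h_cont.
  have [s /Ss[hs _]] := left _ (hasderiv_near w1d hneg).
  by rewrite ltNge hs.
split=> //; rewrite leNgt; apply/negP => Vx.
have V2 : 0 < - V (w1 t) (w2 t) / 2 by rewrite divr_gt0// oppr_gt0.
have Hh := hasderiv_near w1d ((cvgrPdist_lt _ _).1 (@h_cont (w1 t)) _ V2).
have HU := zeta_near w1d w2d hx
  ((cvgrPdist_lt _ _).1 (@U_cont (w2 t - zs (w1 t))) _ V2).
have [|s st [H1 H2]] := left (fun s =>
  `|h (w1 t) - h (w1 s)| < - V (w1 t) (w2 t) / 2 /\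
  (0 <= h (w1 s) ->
   `|U (w2 t - zs (w1 t)) - U (w2 s - zs (w1 s))| < - V (w1 t) (w2 t) / 2)).
  by apply: (filterS2 _ _ (Hh _) (HU _)) => s H1 H2 As; split; [exact: H1|exact: H2].
have [hs] := Ss _ st; have := H2 hs; move: H1.
by rewrite !ltr_norml => /andP[+ _] /andP[_ +]; rewrite /V; lra.
Unshelve. all: by end_near. Qed.

(** The velocities have to match the vector field only where [0 <= h], so that the result also
    covers a feedback altered outside that set. *)
Lemma superlevel_invariant eps (T : \bar R) w1 w2 d1 d2 :
  0 < eps < b3 / (c2 + c1 ^+ 2 / eta + 1) ->
  (forall t, 0 <= t -> (t%:E < T)%E ->
     hasderiv [set s | 0 <= s /\ (s%:E < T)%E] w1 t (d1 t) /\
     hasderiv [set s | 0 <= s /\ (s%:E < T)%E] w2 t (d2 t)) ->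
  (forall t, 0 <= h (w1 t) -> d1 t = f (w1 t) (w2 t) /\
     d2 t = eps^-1 *: g (w2 t) (w1 t)) ->
  S (w1 0) (w2 0) -> forall t, 0 <= t -> (t%:E < T)%E -> S (w1 t) (w2 t).
Proof.
move=> eps0 wd dE S0; apply: real_induction => //.
- move=> t t0 tT St; have [w1d w2d] := wd _ t0 tT.
  have [d1E d2E] := dE _ St.1; rewrite d1E in w1d; rewrite d2E in w2d.
  apply: filterS (superlevel_right eps0 St w1d w2d) => s H ts sT; apply: H => //.
  by split=> //; rewrite (le_trans t0)// ltW.
- move=> t t0 tT Ss; have [w1d w2d] := wd _ (ltW t0) tT.
  apply: (superlevel_left t0 _ w1d w2d Ss) => s /andP[s0 st]; split=> //.
  by rewrite (lt_trans _ tT)// lte_fin.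
Qed.

End Barrier.

(** * Euclidean norm, compactness bounds, and the closed loop *)

Section EuclideanNorm.
Context {R : realType}.

Lemma norm_le_enorm n (v : 'rV[R]_n) : `|v| <= enorm v.
Proof.
apply: ler_mx_coord => [|i j]; first exact: sqrtr_ge0.
rewrite ord1 -sqrtr_sqr ler_wsqrtr// /dotv (bigD1 j)//= -expr2 lerDl.
by apply: sumr_ge0 => k _; rewrite -expr2 sqr_ge0.
Qed.

Lemma dotv_le n (v w : 'rV[R]_n) : `|dotv v w| <= n%:R * `|v| * `|w|.
Proof.
rewrite (le_trans (ler_norm_sum _ _ _))//.
rewrite (@le_trans _ _ (\sum_(i < n) `|v| * `|w|))//.
  apply: ler_sum => i _; rewrite normrM.
  by apply: ler_pM => //; exact: coord_ler_norm.
by rewrite sumr_const card_ord -[leLHS]mulr_natl mulrA.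
Qed.

Lemma enorm_le n (v : 'rV[R]_n) : enorm v <= n%:R * `|v|.
Proof.
have n0 : 0 <= n%:R * `|v| by rewrite mulr_ge0.
rewrite -[leRHS]ger0_norm// -sqrtr_sqr ler_wsqrtr//.
rewrite (le_trans (ler_norm _))// (le_trans (dotv_le _ _))//.
rewrite exprMn -mulrA -expr2 ler_wpM2r ?sqr_ge0// -natrX ler_nat.
by case: (n) => // k; rewrite -[leqLHS]expn1 leq_pexp2l.
Qed.

Lemma dotvB n (x v w : 'rV[R]_n) : dotv x (v - w) = dotv x v - dotv x w.
Proof.
by rewrite /dotv -sumrB; apply: eq_bigr => i _; rewrite !mxE mulrBr.
Qed.

Lemma dotvZ n a (x v : 'rV[R]_n) : dotv x (a *: v) = a * dotv x v.
Proof.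
by rewrite /dotv mulr_sumr; apply: eq_bigr => i _; rewrite !mxE mulrCA.
Qed.

(** The root of a sum of squares is at most the sum of the three Euclidean norms, and each of these
    is at most its dimension times the sup norm. *)
Lemma elipschitz3_norm a b c d L
    (F : 'rV[R]_a -> 'rV[R]_b -> 'rV[R]_c -> 'rV[R]_d) :
  0 <= L -> elipschitz3 L F -> forall x x' y y' u u',
  `|F x y u - F x' y' u'| <=
  L * (a + b + c)%:R * (`|x - x'| + `|y - y'| + `|u - u'|).
Proof.
move=> L0 FL x x' y y' u u'.
rewrite (le_trans (norm_le_enorm _))// (le_trans (FL _ _ _ _ _ _))//.
rewrite -mulrA ler_wpM2l//.
set s := `|x - x'| + _ + _.
have E k (v : 'rV[R]_k) : 0 <= enorm v by exact: sqrtr_ge0.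
have H : enorm (x - x') + enorm (y - y') + enorm (u - u') <= (a + b + c)%:R * s.
  rewrite !natrD !mulrDl; apply: lerD; first apply: lerD;
    (apply: le_trans (enorm_le _) _; rewrite ler_wpM2l// /s).
  - by rewrite -addrA lerDl addr_ge0.
  - by rewrite addrAC lerDr addr_ge0.
  - by rewrite lerDr addr_ge0.
apply: le_trans H; set p := enorm _; set q := enorm _; set r := enorm _.
have pqr : 0 <= p + q + r by rewrite !addr_ge0// E.
rewrite -[leRHS]ger0_norm// -sqrtr_sqr ler_wsqrtr//.
have := mulr_ge0 (E _ (x - x')) (E _ (y - y')).
have := mulr_ge0 (E _ (x - x')) (E _ (u - u')).
have := mulr_ge0 (E _ (y - y')) (E _ (u - u')).
rewrite -/p -/q -/r; lra.
Qed.

Lemma diff_dotv n (F : 'rV[R]_n -> R) x v :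
  differentiable F x -> 'd F x v = dotv (gradient F x) v.
Proof.
move=> Fx; rewrite {1}(row_sum_delta v) linear_sum /dotv.
by apply: eq_bigr => i _; rewrite linearZ/= mxE deriveE// mulrC.
Qed.

Lemma differentiable_near n (F : 'rV[R]_n -> R) x : differentiable F x ->
  forall e, 0 < e -> \forall y \near x,
    `|F y - F x - dotv (gradient F x) (y - x)| <= e * `|y - x|.
Proof.
move=> Fx e e0; have /diff_locallyP[_ /eqaddoP H] := Fx.
rewrite (near_shift 0); apply: filterS (H _ e0) => z.
by rewrite /= subr0 addrK !fctE opprD addrA diff_dotv.
Qed.

End EuclideanNorm.

(** * Relative continuity and bounds on compact sets *)

Section CompactBounds.
Context {R : realType}.

Lemma compact_within_bounded (X W : normedModType R) (C : set X) (phi : X -> W) :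
  compact C -> {within C, continuous phi} ->
  exists2 B, 0 <= B & forall x, C x -> `|phi x| <= B.
Proof.
move=> cC /continuous_compact/(_ cC)/compact_bounded[B [_ HB]].
exists (`|B| + 1); first by rewrite addr_ge0.
move=> x Cx; apply: (HB (`|B| + 1)); last by exists x.
by rewrite (le_lt_trans (ler_norm B))// ltrDl.
Qed.

Lemma locally_lip_within_continuous (X W : normedModType R) (C : set X)
    (phi : X -> W) (K : R) :
  (forall x, C x -> \forall y \near x, C y -> `|phi y - phi x| <= K * `|y - x|) ->
  {within C, continuous phi}.
Proof.
move=> H; apply/subspace_continuousP => x Cx; apply/cvgrPdist_le => e e0.
have K1 : 0 < `|K| + 1 by rewrite ltr_wpDl.
have eK : 0 < e / (`|K| + 1) by rewrite divr_gt0.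
rewrite near_withinE; apply: (filterS2 _ _ (H x Cx) (near_ball x _ eK)) => y Hy xy Cy.
rewrite distrC (le_trans (Hy Cy))// (@le_trans _ _ ((`|K| + 1) * `|y - x|))//.
  by rewrite ler_wpM2r// (le_trans (ler_norm K))// lerDl.
move: xy; rewrite -ball_normE/= distrC ltr_pdivlMr// mulrC => xy.
exact: ltW.
Qed.

Lemma within_continuous_comp (X P W : normedModType R) (C : set X) (D : set P)
    (psi : X -> P) (phi : P -> W) :
  {within C, continuous psi} -> (forall x, C x -> D (psi x)) ->
  {within D, continuous phi} -> {within C, continuous (fun x => phi (psi x))}.
Proof.
move=> /subspace_continuousP psic CD /subspace_continuousP phic.
apply/subspace_continuousP => x Cx; apply/cvgrPdist_le => e e0.
have /cvgrPdist_le/(_ _ e0) := phic _ (CD _ Cx).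
rewrite !near_withinE => /(psic x Cx) H.
have {}H : nbhs x (fun y => C y -> D (psi y) -> `|phi (psi x) - phi (psi y)| <= e) := H.
by apply: filterS H => y Hy Cy; exact: Hy Cy (CD _ Cy).
Qed.

End CompactBounds.

(** * Local Lipschitz bound for the equilibrium under feedback *)

Section EquilibriumMap.
Context {R : realType}.

(** Expansion in the standard basis turns bounds at finitely many vectors, which pointwise
    continuity of the derivative provides over a compact set, into an operator norm bound. *)
Lemma linear_norm_le (n m : nat) (W : normedModType R)
    (F : {linear ('rV[R]_n * 'rV[R]_m)%type -> W}) (B1 B2 : R) v :
  (forall i, `|F (delta_mx 0 i, 0)| <= B1) ->
  (forall j, `|F (0, delta_mx 0 j)| <= B2) ->
  `|F v| <= (n%:R * B1 + m%:R * B2) * `|v|.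
Proof.
move=> HB1 HB2; case: v => v1 v2.
have E1 : ((v1, 0) : 'rV[R]_n * 'rV[R]_m) = \sum_i v1 0 i *: (delta_mx 0 i, 0).
  rewrite {1}(row_sum_delta v1).
  rewrite (big_morph (fun v => (v, 0) : 'rV[R]_n * 'rV[R]_m) (op1 := +%R) (id1 := 0))//.
    by apply: eq_bigr => i _; rewrite -[in LHS](scaler0 _ (v1 0 i)).
  by move=> a b; rewrite -[in LHS](addr0 0).
have E2 : ((0, v2) : 'rV[R]_n * 'rV[R]_m) = \sum_i v2 0 i *: (0, delta_mx 0 i).
  rewrite {1}(row_sum_delta v2).
  rewrite (big_morph (fun v => (0, v) : 'rV[R]_n * 'rV[R]_m) (op1 := +%R) (id1 := 0))//.
    by apply: eq_bigr => i _; rewrite -[in LHS](scaler0 _ (v2 0 i)).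
  by move=> a b; rewrite -[in LHS](addr0 0).
have -> : (v1, v2) = (v1, 0) + (0, v2) :> 'rV[R]_n * 'rV[R]_m.
  by rewrite -[v1 in LHS]addr0 -[v2 in LHS]add0r.
rewrite linearD (le_trans (ler_normD _ _))// mulrDl.
have sum_le k (w : 'rV[R]_k) (G : 'I_k -> W) (B c : R) : `|w| <= c ->
    (forall i, `|G i| <= B) -> `|\sum_i w 0 i *: G i| <= k%:R * B * c.
  move=> wc GB; rewrite (le_trans (ler_norm_sum _ _ _))//.
  rewrite (@le_trans _ _ (\sum_(i < k) B * c))//.
    apply: ler_sum => i _; rewrite normrZ mulrC ler_pM//.
    by rewrite (le_trans _ wc)// coord_ler_norm.
  by rewrite sumr_const card_ord -[leLHS]mulr_natl mulrA.
apply: lerD.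
  rewrite E1 linear_sum; under eq_bigr do rewrite linearZ.
  apply: sum_le => //; rewrite -E1 prod_normE/= le_max.
  by rewrite -[v1 in leLHS]addr0 lexx.
rewrite E2 linear_sum; under eq_bigr do rewrite linearZ.
apply: sum_le => //; rewrite -E2 prod_normE/= le_max.
by rewrite add0r lexx orbT.
Qed.

(** Along the graph of [p] over the compact set [C] the derivative of [zeq] has operator norm at
    most some [K0]. Differentiability with tolerance 1 then gives the constant [K0 + 1] along the
    graph, whose own Lipschitz constant is [1 + Kp]. Only the constant is uniform; the neighbourhood
    depends on [x]. *)
Lemma equilibrium_locally_lip n m (W : normedModType R) (C Sx : set 'rV[R]_n)
    (Us : set 'rV[R]_m) (zeq : 'rV[R]_n * 'rV[R]_m -> W)
    (p : 'rV[R]_n -> 'rV[R]_m) Kp :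
  compact C -> C `<=` Sx -> (forall x, C x -> Us (p x)) -> 0 <= Kp ->
  (forall x y, C x -> C y -> `|p x - p y| <= Kp * `|x - y|) ->
  C1_on (Sx `*` Us) zeq ->
  exists2 K, 0 <= K & forall x, C x ->
    \forall y \near x, C y -> `|zeq (y, p y) - zeq (x, p x)| <= K * `|y - x|.
Proof.
move=> cC CS pU Kp0 pK [DF [zd DFc]].
have pairB x y : C x -> C y ->
    `|(y, p y) - (x, p x) : 'rV[R]_n * 'rV[R]_m| <= (1 + Kp) * `|y - x|.
  move=> Cx Cy; rewrite prod_normE/= ge_max mulrDl mul1r; apply/andP; split.
    by rewrite lerDl mulr_ge0.
  by rewrite (le_trans (pK _ _ Cy Cx))// lerDr.
have graphC : {within C, continuous (fun x => (x, p x))}.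
  apply: (@locally_lip_within_continuous _ _ _ C _ (1 + Kp)) => x Cx.
  by near=> y => Cy; exact: pairB.
have CD x : C x -> (Sx `*` Us) (x, p x) by move=> Cx; split; [exact: CS|exact: pU].
have bnd v : exists B, forall x, C x -> `|DF (x, p x) v| <= B.
  have := within_continuous_comp graphC CD (DFc v).
  by move=> /(compact_within_bounded cC)[B _ HB]; exists B.
have bnds k (e : 'I_k -> 'rV[R]_n * 'rV[R]_m) : exists B, 0 <= B /\
    forall i x, C x -> `|DF (x, p x) (e i)| <= B.
  have /choice[B HB] i := bnd (e i).
  exists (\sum_i `|B i|); split; first exact: sumr_ge0.
  move=> i x Cx; rewrite (le_trans (HB i x Cx))// (le_trans (ler_norm _))//.
  by rewrite (bigD1 i)//= lerDl sumr_ge0.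
have [B1 [B10 HB1]] := bnds n (fun i => (delta_mx 0 i, 0)).
have [B2 [B20 HB2]] := bnds m (fun j => (0, delta_mx 0 j)).
pose K0 := n%:R * B1 + m%:R * B2.
have K00 : 0 <= K0 by rewrite addr_ge0// mulr_ge0.
exists ((K0 + 1) * (1 + Kp)); first by rewrite mulr_ge0// addr_ge0.
move=> x Cx; have [_ /(_ 1 ltr01)] := zd _ (CD _ Cx).
rewrite near_withinE => H.
have /subspace_continuousP/(_ x Cx) gx := graphC.
have {}H : \forall y \near x, C y -> (Sx `*` Us) (y, p y) ->
    `|zeq (y, p y) - zeq (x, p x) - DF (x, p x) ((y, p y) - (x, p x))| <=
    1 * `|(y, p y) - (x, p x) : 'rV[R]_n * 'rV[R]_m| by exact: gx _ H.
apply: filterS H => y Hy Cy; have {}Hy := Hy Cy (CD _ Cy).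
set D := (y, p y) - (x, p x) in Hy.
have HD : `|DF (x, p x) D| <= K0 * `|D|.
  by apply: linear_norm_le => i; [exact: HB1|exact: HB2].
rewrite -(subrK (DF (x, p x) D) (zeq (y, p y) - zeq (x, p x))).
rewrite (le_trans (ler_normD _ _))// (le_trans (lerD Hy HD))//.
rewrite -mulrDl -mulrA addrC ler_wpM2l ?(addr_ge0 K00 ler01)//.
exact: pairB.
Unshelve. all: by end_near. Qed.

End EquilibriumMap.

(** * The closed-loop vector field *)

Section ClosedLoop.
Context {R : realType}.

Lemma hasderiv_fst (E F : normedModType R) (A : set R) (w : R -> E * F) t d :
  hasderiv A w t d -> hasderiv A (fun s => (w s).1) t d.1.
Proof.
move=> wd e /wd; apply: filterS => s Hs /Hs; rewrite prod_normE/=.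
by rewrite ge_max => /andP[].
Qed.

Lemma hasderiv_snd (E F : normedModType R) (A : set R) (w : R -> E * F) t d :
  hasderiv A w t d -> hasderiv A (fun s => (w s).2) t d.2.
Proof.
move=> wd e /wd; apply: filterS => s Hs /Hs; rewrite prod_normE/=.
by rewrite ge_max => /andP[].
Qed.

Lemma closed_loop_lipschitz n p m
    (f : 'rV[R]_n -> 'rV[R]_p -> 'rV[R]_m -> 'rV[R]_n)
    (g : 'rV[R]_p -> 'rV[R]_n -> 'rV[R]_m -> 'rV[R]_p) (Lf Lg Kp eps : R) q :
  0 <= Lf -> 0 <= Lg -> 0 <= Kp -> 0 < eps ->
  elipschitz3 Lf f -> elipschitz3 Lg g ->
  (forall x y, `|q x - q y| <= Kp * `|x - y|) ->
  exists2 L, 0 < L & forall v w,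
    `|closed_loop f g q eps v - closed_loop f g q eps w| <= L * `|v - w|.
Proof.
move=> Lf0 Lg0 Kp0 e0 fL gL qL.
(* In [2 + Kp], the slow and the fast argument count once each and the feedback contributes [Kp]. *)
pose a := Lf * (n + p + m)%:R * (2 + Kp).
pose b := eps^-1 * (Lg * (p + n + m)%:R * (2 + Kp)).
have K2 : 0 <= 2 + Kp by rewrite addr_ge0.
have a0 : 0 <= a by rewrite !mulr_ge0.
have ei : 0 <= eps^-1 by rewrite invr_ge0 ltW.
have b0 : 0 <= b by rewrite !mulr_ge0.
exists (a + b + 1); first by rewrite ltr_wpDl// addr_ge0.
move=> v w; have [v1 v2] : `|v.1 - w.1| <= `|v - w| /\ `|v.2 - w.2| <= `|v - w|.
  by rewrite [in X in X /\ _]prod_normE [in X in _ /\ X]prod_normE !le_max !lexx orbT.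
have qv : `|q v.1 - q w.1| <= Kp * `|v - w|.
  by rewrite (le_trans (qL _ _))// ler_wpM2l.
have vw0 : 0 <= `|v - w| by exact: normr_ge0.
rewrite [leLHS]prod_normE/= ge_max; apply/andP; split.
  rewrite (@le_trans _ _ (a * `|v - w|))//.
    rewrite (le_trans (elipschitz3_norm Lf0 fL _ _ _ _ _ _))//.
    by rewrite /a -[leRHS]mulrA ler_wpM2l ?mulr_ge0//; lra.
  by rewrite ler_wpM2r//; lra.
rewrite (@le_trans _ _ (b * `|v - w|))//.
  rewrite -scalerBr normrZ (ger0_norm ei) /b -[leRHS]mulrA ler_wpM2l//.
  rewrite (le_trans (elipschitz3_norm Lg0 gL _ _ _ _ _ _))//.
  by rewrite -[leRHS]mulrA ler_wpM2l ?mulr_ge0//; lra.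
by rewrite ler_wpM2r//; lra.
Qed.

End ClosedLoop.

Theorem theorem1 (R : realType) (n p m : nat)
  (n_gt0 : (0 < n)%N) (p_gt0 : (0 < p)%N) (m_gt0 : (0 < m)%N)
  (Uset : set 'rV[R]_m) (Sx : set 'rV[R]_n)
  (f : 'rV[R]_n -> 'rV[R]_p -> 'rV[R]_m -> 'rV[R]_n)
  (g : 'rV[R]_p -> 'rV[R]_n -> 'rV[R]_m -> 'rV[R]_p)
  (* (i) *)
  (Lf Lg : R) (Lf_gt0 : 0 < Lf) (Lg_gt0 : 0 < Lg)
  (f_lip : elipschitz3 Lf f) (g_lip : elipschitz3 Lg g)
  (* (ii) *)
  (zeq : 'rV[R]_n * 'rV[R]_m -> 'rV[R]_p)
  (zeq_C1 : C1_on (Sx `*` Uset) zeq)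
  (g_zeq : forall x u, Sx x -> Uset u -> g (zeq (x, u)) x u = 0)
  (* (iii) *)
  (h : 'rV[R]_n -> R)
  (h_diff : forall x, differentiable h x) (h_C1 : continuous (gradient h))
  (C_compact : compact (superlevel h)) (C_Sx : superlevel h `<=` Sx)
  (pi : 'rV[R]_n -> 'rV[R]_m)
  (pi_U : forall x, superlevel h x -> Uset (pi x))
  (Lpi : R) (pi_lip : elipschitz_on Lpi (superlevel h) pi)
  (pi_diff : differentiable_on (superlevel h) pi)
  (alpha : R -> R) (alpha_K : class_Kinfty alpha)
  (Lalpha : R) (alpha_lip : Lalpha.-lipschitz_([set` `[0, +oo[]) alpha)
  (eta : R) (eta_gt0 : 0 < eta)
  (barrier : forall x, superlevel h x ->
     dotv (gradient h x) (f x (zeq (x, pi x)) (pi x)) >= - alpha (h x) + eta)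
  (* (iv) *)
  (U : 'rV[R]_p -> R)
  (U_cont : continuous U) (U_diff : forall z, differentiable U z)
  (b1 b2 b3 b4 : R)
  (b1_gt0 : 0 < b1) (b2_gt0 : 0 < b2) (b3_gt0 : 0 < b3) (b4_gt0 : 0 < b4)
  (U_bounds : forall z, b1 * enorm z ^+ 2 <= U z <= b2 * enorm z ^+ 2)
  (U_decrease : forall z x u, Sx x -> Uset u ->
     dotv (gradient U z) (g (z + zeq (x, u)) x u) <= - b3 * enorm z ^+ 2)
  (U_grad : forall z, enorm (gradient U z) <= b4 * enorm z) :
  exists epsbar : R, 0 < epsbar /\
    forall eps : R, 0 < eps < epsbar ->
      forward_invariant (closed_loop f g pi eps) (Cfull h U zeq pi).
Proof.
pose kn := n%:R : R; pose kp := p%:R : R.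
(* The absolute value is there because the sign of [Lpi] is not prescribed; [kn] converts the
   Euclidean norm of [x - y] to the sup norm. *)
have piK x y : superlevel h x -> superlevel h y ->
    `|pi x - pi y| <= `|Lpi| * kn * `|x - y|.
  move=> Cx Cy; rewrite (le_trans (norm_le_enorm _))// (le_trans (pi_lip _ _ Cx Cy))//.
  rewrite (@le_trans _ _ (`|Lpi| * enorm (x - y)))//.
    by rewrite ler_wpM2r ?ler_norm// sqrtr_ge0.
  by rewrite -mulrA ler_wpM2l// enorm_le.
have Kp0 : 0 <= `|Lpi| * kn by rewrite mulr_ge0.
have [K K0 zK] := equilibrium_locally_lip C_compact C_Sx pi_U Kp0 piK zeq_C1.
have [M M0 gradM] : exists2 M, 0 <= M &
    forall x, superlevel h x -> `|gradient h x| <= M.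
  by apply: compact_within_bounded => //; exact: continuous_subspaceT.
have fK := elipschitz3_norm (ltW Lf_gt0) f_lip.
set kf := Lf * _ in fK.
have kf0 : 0 <= kf by rewrite mulr_ge0// ltW.
have [F0 _ fF0] : exists2 F0, 0 <= F0 & forall x, superlevel h x ->
    `|f x (zeq (x, pi x)) (pi x)| <= F0.
  apply: compact_within_bounded => //.
  apply: (@locally_lip_within_continuous _ _ _ _ _ (kf * (1 + K + `|Lpi| * kn))).
  move=> x Cx; apply: filterS (zK x Cx) => y /[swap] Cy /(_ Cy) zxy.
  rewrite (le_trans (fK _ _ _ _ _ _))// -mulrA ler_wpM2l// !mulrDl mul1r.
  by rewrite !lerD// piK.
pose zs x := zeq (x, pi x).
pose fpi x z := f x z (pi x); pose gpi z x := g z x (pi x).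
pose dh x v := dotv (gradient h x) v; pose dU z v := dotv (gradient U z) v.
(* Constants for the sup norm. Upper bounds by the Euclidean norm acquire factors [kp], and
   [dotv_le] adds one more in [B4]; [b1] and [b3] survive because the sup norm is the smaller
   one. *)
pose B2 := b2 * kp ^+ 2; pose B4 := kp * (b4 * kp).
have kp0 : 0 < kp by rewrite ltr0n.
have B20 : 0 < B2 by rewrite mulr_gt0// exprn_gt0.
have B40 : 0 < B4 by rewrite !mulr_gt0.
have hc : continuous h by move=> x; exact: differentiable_continuous.
have dhM x v : 0 <= h x -> `|dh x v| <= kn * M * `|v|.
  by move=> hx; rewrite (le_trans (dotv_le _ _))// ler_wpM2r// ler_wpM2l// gradM.
have dUM z v : `|dU z v| <= B4 * `|z| * `|v|.
  rewrite (le_trans (dotv_le _ _))// ler_wpM2r// /B4 -!mulrA ler_wpM2l//.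
  rewrite (le_trans (norm_le_enorm _))// (le_trans (U_grad _))//.
  by rewrite ler_wpM2l ?enorm_le// ltW.
have fl x z z' : 0 <= h x -> `|fpi x z - fpi x z'| <= kf * `|z - z'|.
  move=> _; rewrite (le_trans (fK _ _ _ _ _ _))// ler_wpM2l//.
  by rewrite !subrr !normr0 add0r addr0.
(* Since [alpha 0 = 0], the Lipschitz bound between [h x] and 0 replaces [alpha (h x)] by a linear
   term. *)
have barrier' x : 0 <= h x -> eta - `|Lalpha| * h x <= dh x (fpi x (zs x)).
  move=> hx; apply: le_trans (barrier _ hx).
  have [_ _ _ a0 _] := alpha_K.
  have := alpha_lip (h x, 0); rewrite /= !in_itv/= !andbT hx lexx a0 !subr0.
  move=> /(_ (conj isT isT)); rewrite (ger0_norm hx) => ah.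
  have : Lalpha * h x <= `|Lalpha| * h x by rewrite ler_wpM2r// ler_norm.
  have := ler_norm (alpha (h x)); lra.
have UB z : b1 * `|z| ^+ 2 <= U z <= B2 * `|z| ^+ 2.
  have /andP[U1 U2] := U_bounds z; apply/andP; split.
    by rewrite (le_trans _ U1)// ler_pM2l// lerXn2r ?nnegrE ?sqrtr_ge0// norm_le_enorm.
  rewrite (le_trans U2)// /B2 -mulrA ler_pM2l// -exprMn lerXn2r ?nnegrE ?sqrtr_ge0//.
    by rewrite mulr_ge0// ltW.
  exact: enorm_le.
have Udec z x : 0 <= h x -> dU z (gpi (z + zs x) x) <= - b3 * `|z| ^+ 2.
  move=> hx; apply: le_trans (U_decrease z x (pi x) (C_Sx _ hx) (pi_U _ hx)) _.
  by rewrite !mulNr lerN2 ler_pM2l// lerXn2r ?nnegrE ?sqrtr_ge0// norm_le_enorm.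
pose c1 := kn * M * kf + B4 * K * F0; pose c2 := `|Lalpha| * B2 + B4 * K * kf.
have c20 : 0 <= c2 by rewrite addr_ge0 ?mulr_ge0// ltW.
have c10 : 0 <= c1 ^+ 2 / eta by rewrite divr_ge0 ?sqr_ge0// ltW.
(* The threshold of [boundary_drift] for the converted constants; it is fixed before the initial
   state is introduced. *)
exists (b3 / (c2 + c1 ^+ 2 / eta + 1)); split.
  by rewrite divr_gt0// ltr_wpDl// addr_ge0.
move=> eps eps_lt w0 Cw0; have /andP[eps0 _] := eps_lt.
(* Stated for any feedback [q] agreeing with [pi] on the compact set: it serves for arbitrary
   solutions with [q = pi], and for the Picard solution with the extended feedback. *)
have inv q T w : (forall x, superlevel h x -> q x = pi x) -> w 0 = w0 ->
    solution_on (closed_loop f g q eps) T w ->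
    forall t, 0 <= t -> (t%:E < T)%E -> Cfull h U zeq pi (w t).
  move=> qpi w0E ws.
  have wd t : 0 <= t -> (t%:E < T)%E ->
      hasderiv [set s | 0 <= s /\ (s%:E < T)%E] w t (closed_loop f g q eps (w t)).
    by move=> t0 tT; apply/hasderivP; exact: ws.
  apply: (@superlevel_invariant R _ _ fpi gpi zs h dh U dU K (kn * M) kf F0
    `|Lalpha| b1 B2 b3 B4 eta _ _ _ _ _ _ _ _ _ _ _ _ _ _ _ _ _ _ _ _ _ _ _ _
    eps T (fun s => (w s).1) (fun s => (w s).2)
    (fun s => (closed_loop f g q eps (w s)).1)
    (fun s => (closed_loop f g q eps (w s)).2)) => //.
  - by rewrite mulr_ge0.
  - by move=> *; exact: dotvB.
  - by move=> *; exact: dotvZ.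
  - by move=> *; exact: dotvB.
  - by move=> *; exact: dotvZ.
  - by move=> x _; exact: differentiable_near.
  - by move=> x; exact: differentiable_near.
  - by move=> t t0 tT; split; [exact: hasderiv_fst (wd _ _ _)|exact: hasderiv_snd (wd _ _ _)].
  - by move=> t /qpi qE; rewrite /closed_loop/= qE.
  - by rewrite w0E.
split; last by move=> T w w0E ws; exact: inv.
have [q [qpi qL]] := lipschitz_extension Kp0 piK.
have [L L0 FL] := closed_loop_lipschitz (ltW Lf_gt0) (ltW Lg_gt0) Kp0 eps0 f_lip g_lip qL.
have [w [w0E wd]] := picard_global w0
  (antiderivable_prod (@antiderivable_rV R n) (@antiderivable_rV R p))
  (geometric_complete_prod (@geometric_complete_rV R n) (@geometric_complete_rV R p)) L0 FL.
have ws : solution_on (closed_loop f g q eps) +oo%E w.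
  move=> t t0 _; apply/hasderivP => e e0; apply: filterS (wd t t0 e e0) => s H [s0 _].
  exact: H.
exists w; split=> // t t0 tT.
have [hx _] := inv _ _ _ qpi w0E ws _ t0 tT.
have -> : closed_loop f g pi eps (w t) = closed_loop f g q eps (w t).
  by rewrite /closed_loop qpi.
exact: ws.
Qed.
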